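(* Let $\mathcal H$ be a real Hilbert space, $t_0>0$, and let $f:\mathcal H\to\mathbb R$ be a convex $\mathcal C^2(\mathcal H)$ function which is bounded from below. Let $e:[t_0,+\infty[\to\mathcal H$ be continuously differentiable with $\int_{t_0}^{+\infty}\|e(t)\|dt<+\infty$ and $\int_{t_0}^{+\infty}\|\dot e(t)\|dt<+\infty$. Let $\alpha,\beta>0$. Let $x:[t_0,+\infty[\to\mathcal H$ be a solution trajectory of $$\ddot x(t)+\frac{\alpha}{t}\dot x(t)+\beta\frac{d}{dt}\big(\nabla f(x(t))+e(t)\big)+\nabla f(x(t))+e(t)=0,$$ and define $u(t):=x(t)+\beta\int_{t_0}^t\nabla f(x(s))ds$. Then: (i) $\sup_{t\ge t_0}\|\dot u(t)\|<+\infty$; (ii) $\int_{t_0}^{+\infty}\frac1t\|\dot x(t)\|^2dt<+\infty$, $\int_{t_0}^{+\infty}\|\nabla f(x(t))\|^2dt<+\infty$, $\int_{t_0}^{+\infty}\frac1t\|\dot u(t)\|^2dt<+\infty$; (iii) $\lim_{t\to+\infty}\|\dot u(t)\|=0$, $\lim_{t\to+\infty}\|\dot x(t)\|=0$, $\lim_{t\to+\infty}\|\nabla f(x(t))\|=0$; (iv) $\lim_{t\to+\infty}f(x(t))=\inf_{\mathcal H}f$.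
   Context: The set of minimizers of $f$ may be empty here. *)

(* Defs.v *)
From HB Require Import structures.
From mathcomp Require Import all_boot all_order all_algebra.
From mathcomp Require Import all_classical all_reals all_analysis.

Set Implicit Arguments.
Unset Strict Implicit.
Unset Printing Implicit Defensive.

Import Order.TTheory GRing.Theory Num.Theory.
Import numFieldNormedType.Exports.

Local Open Scope classical_set_scope.
Local Open Scope ring_scope.

(* A real Hilbert space is a complete normed space whose norm is induced by a
   (symmetric, bilinear) inner product: we record the inner product as an
   extra datum [inner] on a [completeNormedModType R]. *)
Definition is_inner_product (R : realType) (V : normedModType R)
  (inner : V -> V -> R) : Prop :=
  [/\ forall x y, inner x y = inner y x,
      forall a x y z, inner (a *: x + y) z = a * inner x z + inner y z
    & forall x, `|x| ^+ 2 = inner x x].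

Definition convex_fun (R : realType) (V : normedModType R) (f : V -> R) : Prop :=
  forall (x y : V) (l : R), 0 <= l <= 1 ->
    f (l *: x + (1 - l) *: y) <= l * f x + (1 - l) * f y.

Definition is_gradient (R : realType) (V : normedModType R)
  (inner : V -> V -> R) (f : V -> R) (gradf : V -> V) : Prop :=
  forall x, differentiable f x /\ forall h, 'd f x h = inner (gradf x) h.

(* f is C^2: f is differentiable with gradient [gradf], and [gradf] is
   Frechet differentiable with a differential that is continuous for the
   operator norm. *)
Definition C2_with_gradient (R : realType) (V : normedModType R)
  (inner : V -> V -> R) (f : V -> R) (gradf : V -> V) : Prop :=
  [/\ is_gradient inner f gradf,
      forall x, differentiable gradf x
    & forall x (eps : R), 0 < eps -> exists2 del : R, 0 < del &
        forall y, `|y - x| < del ->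
          forall h, `|'d gradf y h - 'd gradf x h| <= eps * `|h| ].

(* [h] is C^1 on the closed half-line [t0, +oo[ with derivative [g]:
   h is differentiable on ]t0, +oo[ with derivative g there, and both h and g
   are continuous on [t0, +oo[ (so g t0 is the right derivative at t0). *)
Definition C1_on_ge (R : realType) (V : normedModType R) (t0 : R)
  (h g : R -> V) : Prop :=
  [/\ forall t, t0 < t -> derivable h t 1 /\ derive1 h t = g t,
      {within `[t0, +oo[, continuous h}
    & {within `[t0, +oo[, continuous g}].

(* Main.v *)
(** Write [g = gradf x], [p = u' = v + beta g] and [eps = e + beta e'], so that the
    equation reads [p' = - (alpha / t) v - g - eps], and let [m = inf f].

    Two Lyapunov functions are used.  With
      [W = |p|^2 / 2 + (1 + alpha beta / t) (f x - m)]
    one gets [W' <= - (alpha / t) |v|^2 - beta |g|^2 + |p| |eps|], and with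
      [Z = |v|^2 / 2 + f x - m]
    the monotonicity of the gradient, in the form [<g', v> >= 0], gives
    [Z' <= |v| |eps|].  Since [eps] is integrable, a Gronwall argument shows that both
    are bounded and decrease up to a summable error, and that
    [(alpha / t) |v|^2 + beta |g|^2] is integrable.  Such a function tends to [0] as soon
    as it is frequently small.

    If [W] stayed above [rho > 0], then for [z] with [f z < m + rho / 2] the bounded
    quantity [<p, x - z> / t] would have a derivative at most
    [- (rho / 4) / t + (integrable)], which is impossible because [1 / t] is not
    integrable; hence [W -> 0], i.e. [p -> 0] and [f x -> m].  Likewise [Z] is frequently
    small since [|v|^2 / t] is integrable, so [v -> 0], and [g = (p - v) / beta -> 0]. *)

Require Import Defs.
From HB Require Import structures.
From mathcomp Require Import all_boot all_order all_algebra.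
From mathcomp Require Import all_classical all_reals all_analysis.
From mathcomp Require Import measurable_realfun ring lra.

Import Order.TTheory GRing.Theory Num.Theory.
Import numFieldNormedType.Exports.

Local Open Scope classical_set_scope.
Local Open Scope ring_scope.

Set Implicit Arguments.
Unset Strict Implicit.
Unset Printing Implicit Defensive.

(** * Calculus on a half-line: primitives, a Gronwall argument, limits at infinity *)

Section half_line.
Context {R : realType}.
Implicit Types (h f F : R -> R) (t s : R).
Notation mu := (@lebesgue_measure R).

Lemma is_derive1_continuous {V : normedModType R} (h : R -> V) t d :
  is_derive t 1 h d -> {for t, continuous h}.
Proof.
by move=> dh; apply/differentiable_continuous/derivable1_diffP; exact: ex_derive.
Qed.

Lemma is_derive1D {V : normedModType R} (f g : R -> V) t a b :
  is_derive t 1 f a -> is_derive t 1 g b ->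
  is_derive t 1 (fun s => f s + g s) (a + b).
Proof. exact: is_deriveD. Qed.

Lemma is_derive1B {V : normedModType R} (f g : R -> V) t a b :
  is_derive t 1 f a -> is_derive t 1 g b ->
  is_derive t 1 (fun s => f s - g s) (a - b).
Proof. exact: is_deriveB. Qed.

Lemma is_derive1Z {V : normedModType R} (k : R) (f : R -> V) t a :
  is_derive t 1 f a -> is_derive t 1 (fun s => k *: f s) (k *: a).
Proof. exact: is_deriveZ. Qed.

Lemma is_derive1M f g t a b :
  is_derive t 1 f a -> is_derive t 1 g b ->
  is_derive t 1 (fun s => f s * g s) (f t * b + g t * a).
Proof. exact: is_deriveM. Qed.

Lemma is_derive1Dc {V : normedModType R} (k : V) (f : R -> V) t a :
  is_derive t 1 f a -> is_derive t 1 (fun s => k + f s) a.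
Proof.
by move=> df; have := is_derive1D (is_derive_cst k t 1) df; rewrite add0r.
Qed.

Lemma ler0_is_derive1_le (t0 : R) h h' :
  (forall t, t0 <= t -> {for t, continuous h}) ->
  (forall t, t0 < t -> is_derive t 1 h (h' t)) ->
  (forall t, t0 < t -> h' t <= 0) ->
  forall s t, t0 <= s -> s <= t -> h t <= h s.
Proof.
move=> ch dh h'0 s t t0s; rewrite le_eqVlt => /predU1P[->//|st].
have [||c] := @MVT R h h' s t st.
- by move=> r; rewrite in_itv/= => /andP[sr _]; apply: dh; exact: le_lt_trans sr.
- apply: continuous_in_subspaceT => r; rewrite inE/= in_itv/= => /andP[sr _].
  by apply: ch; exact: le_trans sr.
rewrite in_itv/= => /andP[sc _] E.
have := h'0 c (le_lt_trans t0s sc); nra.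
Qed.

Lemma continuous_primitive (t0 : R) f : continuous f ->
  exists F, forall t, t0 <= t -> is_derive t 1 F (f t).
Proof.
(* Starting the integral at [t0 - 1] makes [t0] an interior point, so the primitive has a two-sided
   derivative there as well. *)
move=> cf; exists (fun x => (\int[mu]_(t in [set` `[t0 - 1, x]]) (f t))%R) => t t0t.
have [||||dF eF] := @continuous_FTC1_closed R f (t0 - 1) t (t + 1).
- by rewrite ltrDl.
- by apply: continuous_compact_integrable; [exact: segment_compact|exact: continuous_subspaceT].
- by lra.
- exact: cf.
by apply: (DeriveDef dF); rewrite -derive1E.
Qed.

(** [F t - F t0] is the integral over [[t0, t]], which nonnegativity bounds by the integral over the
    half-line. This turns the integrability of the perturbation into a bounded primitive, the form
    used in all later estimates. *)
Lemma integral_lty_primitive_bounded (t0 : R) f F :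
  (forall t, t0 <= t -> {for t, continuous f}) ->
  (forall t, t0 <= t -> 0 <= f t) ->
  (forall t, t0 <= t -> is_derive t 1 F (f t)) ->
  (\int[mu]_(t in `[t0, +oo[) (f t)%:E < +oo)%E ->
  exists K, forall t, t0 <= t -> F t <= K.
Proof.
move=> cf f0 dF fi.
have cfw : {within `[t0, +oo[, continuous f}.
  apply: continuous_in_subspaceT => r; rewrite inE/= in_itv/= andbT; exact: cf.
have mf : measurable_fun `[t0, +oo[ f.
  apply/measurable_fun_itv_obnd_cbndP; apply: open_continuous_measurable_fun => //.
  by move=> x; rewrite inE/= in_itv/= andbT => /ltW; exact: cf.
exists (F t0 + fine (\int[mu]_(t in `[t0, +oo[) (f t)%:E)) => t.
have i0 (A : set R) : A `<=` `[t0, +oo[ -> (0 <= \int[mu]_(t in A) (f t)%:E)%E.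
  move=> A0; apply: integral_ge0 => x /A0; rewrite /= in_itv/= andbT lee_fin; exact: f0.
rewrite le_eqVlt => /predU1P[<-|t0t]; first by rewrite lerDl fine_ge0// i0.
rewrite -lerBlDl.
have sub : `[t0, t] `<=` `[t0, +oo[ by exact: subset_itvl.
have E : (\int[mu]_(x in `[t0, t]) (f x)%:E = (F t)%:E - (F t0)%:E)%E.
  apply: continuous_FTC2 => //.
  - exact: continuous_subspaceW cfw.
  - split.
    + by move=> x; rewrite in_itv/= => /andP[/ltW /dF ? _]; exact: ex_derive.
    + by apply/cvg_at_right_filter/is_derive1_continuous/dF.
    + by apply/cvg_at_left_filter/is_derive1_continuous/dF/ltW.
  - by move=> x; rewrite in_itv/= => /andP[/ltW /dF ? _]; rewrite derive1E; exact: derive_val.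
rewrite -lee_fin fineK ?ge0_fin_numE ?i0//.
rewrite EFinB -E; apply: ge0_subset_integral => //; first exact/measurable_EFinP.
by move=> x; rewrite /= in_itv/= andbT lee_fin; exact: f0.
Qed.

Lemma nonneg_derive1_le (t0 : R) f F :
  (forall t, t0 <= t -> 0 <= f t) ->
  (forall t, t0 <= t -> is_derive t 1 F (f t)) ->
  forall s t, t0 <= s -> s <= t -> F s <= F t.
Proof.
move=> f0 dF s t t0s st; rewrite -lerN2.
apply: (@ler0_is_derive1_le t0 (\- F) (\- f)) t0s st => r.
- by move=> /dF/is_derive1_continuous; exact: continuousN.
- by move=> /ltW/dF ?; apply: is_deriveN.
- by move=> /ltW/f0/=; rewrite oppr_le0.
Qed.

(** A bounded nondecreasing primitive converges to its supremum, and the fundamental theorem of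
    calculus on the half-line then gives the integral a finite value. *)
Lemma primitive_bounded_integral_lty (t0 K : R) f F :
  (forall t, t0 <= t -> {for t, continuous f}) ->
  (forall t, t0 <= t -> 0 <= f t) ->
  (forall t, t0 <= t -> is_derive t 1 F (f t)) ->
  (forall t, t0 <= t -> F t <= K) ->
  (\int[mu]_(t in `[t0, +oo[) (f t)%:E < +oo)%E.
Proof.
move=> cf f0 dF FK.
have ndF := @nonneg_derive1_le t0 f F f0 dF.
(* Freezing [F] at [F t0] on the left of [t0] gives a function that is monotone on the whole
   line. *)
pose G t := F (Num.max t0 t).
have Gl : G t @[t --> +oo] --> sup (range G).
  apply: nondecreasing_cvgr.
  - move=> s t st; apply: ndF; first by rewrite le_max lexx.
    by rewrite ge_max le_max lexx/= le_max st orbT.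
  - by exists K => _ [t _ <-]; apply: FK; rewrite le_max lexx.
rewrite (@ge0_continuous_FTC2y _ f F t0 (sup (range G))) ?ltry//.
- apply: continuous_in_subspaceT => r; rewrite inE/= in_itv/= andbT; exact: cf.
- apply: cvg_trans Gl; apply: near_eq_cvg; near=> t.
  by rewrite /G max_r.
- by move=> x /ltW/dF ?; exact: ex_derive.
- by apply/cvg_at_right_filter/is_derive1_continuous/dF.
- by move=> x; rewrite in_itv/= andbT => /ltW/dF ?; rewrite derive1E; exact: derive_val.
Unshelve. all: by end_near. Qed.

(** Gronwall in two passes. First [(1 + Z) * expR (- E)] is nonincreasing, which bounds [1 + Z] by
    [M0]. With this bound [Z' <= - c + M0 * eta], so [Z + C - M0 * E] is nonincreasing; this bounds
    [C] and, as [C] is nondecreasing, shows that [Z] decreases up to the increments of [M0 * E]. *)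
Lemma lyapunov_bounded (t0 K : R) (Z Z' c eta C E : R -> R) :
  (forall t, t0 <= t -> {for t, continuous Z}) ->
  (forall t, t0 < t -> is_derive t 1 Z (Z' t)) ->
  (forall t, t0 <= t -> is_derive t 1 C (c t)) ->
  (forall t, t0 <= t -> is_derive t 1 E (eta t)) ->
  (forall t, t0 <= t -> [/\ 0 <= Z t, 0 <= c t & 0 <= eta t]) ->
  (forall t, t0 < t -> Z' t <= - c t + (1 + Z t) * eta t) ->
  (forall t, t0 <= t -> E t <= K) ->
  exists M, [/\ forall t, t0 <= t -> Z t <= M,
    forall t, t0 <= t -> C t <= M &
    forall s t, t0 <= s -> s <= t -> Z t <= Z s + M * (E t - E s)].
Proof.
move=> cZ dZ dC dE pos Z'le EK.
have ndE := @nonneg_derive1_le t0 eta E (fun t ht => let: And3 _ _ p := pos t ht in p) dE.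
have ndC := @nonneg_derive1_le t0 c C (fun t ht => let: And3 _ p _ := pos t ht in p) dC.
have dEN t : t0 <= t -> is_derive t 1 (fun s => expR (- E s)) (expR (- E t) * (- eta t)).
  move=> /dE dEt; apply: (@is_derive1_comp R expR (\- E)).
pose M0 := (1 + Z t0) * expR (- E t0) * expR K.
have ZM0 t : t0 <= t -> 1 + Z t <= M0.
  move=> t0t.
  have : (1 + Z t) * expR (- E t) <= (1 + Z t0) * expR (- E t0).
    apply: (@ler0_is_derive1_le t0 (fun s => (1 + Z s) * expR (- E s))
       (fun s => (1 + Z s) * (expR (- E s) * (- eta s)) + expR (- E s) * Z' s)) _ t0t => //.
    - move=> r t0r; apply: continuousM.
        by apply: continuousD; [exact: cst_continuous|exact: cZ].
      exact: is_derive1_continuous (dEN r t0r).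
    - move=> r t0r; have := dEN r (ltW t0r); have := dZ r t0r => dZr dEr.
      exact (is_derive1M (is_derive1Dc (1 : R) dZr) dEr).
    - move=> r t0r; have [Zr cr er] := pos r (ltW t0r).
      have := Z'le r t0r; have := expR_gt0 (- E r); nra.
  rewrite -ler_pdivlMr ?expR_gt0// -expRN opprK => /le_trans; apply.
  rewrite /M0 ler_wpM2l ?ler_expR ?EK// mulr_ge0 ?expR_ge0// addr_ge0//.
  by have [] := pos t0.
have M0_ge1 : 1 <= M0 by have := ZM0 t0 (lexx _); have [] := pos t0 (lexx _); lra.
have decr s t : t0 <= s -> s <= t -> Z t + C t - M0 * E t <= Z s + C s - M0 * E s.
  move=> t0s st.
  apply: (@ler0_is_derive1_le t0 (fun s => Z s + C s - M0 * E s)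
       (fun s => Z' s + c s - M0 * eta s)) t0s st.
  - move=> r t0r; apply: continuousB.
      by apply: continuousD; [exact: cZ|exact: is_derive1_continuous (dC r t0r)].
    by apply: continuousM; [exact: cst_continuous|exact: is_derive1_continuous (dE r t0r)].
  - move=> r t0r; have := dC r (ltW t0r); have := dE r (ltW t0r); have := dZ r t0r.
    move=> dZr dEr dCr.
    exact: is_derive1B (is_derive1D dZr dCr) (is_derive1Z M0 dEr).
  - move=> r t0r; have [_ _ er] := pos r (ltW t0r).
    have := Z'le r t0r; have := ZM0 r (ltW t0r); nra.
(* One constant for the three conclusions: it exceeds [M0], and its remaining terms bound [C]
   through the comparison of times [t0] and [t]. *)
exists (M0 + `|Z t0| + `|C t0| + M0 * (`|K| + `|E t0|)).
have H0 : 0 <= M0 * (`|K| + `|E t0|) by rewrite mulr_ge0 ?addr_ge0//; lra.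
split.
- by move=> t t0t; have := ZM0 t t0t; have := normr_ge0 (Z t0); have := normr_ge0 (C t0); lra.
- move=> t t0t; have := decr t0 t (lexx _) t0t; have [Zt _ _] := pos t t0t.
  have := ler_norm (Z t0); have := ler_norm (C t0); have := EK t t0t.
  have := ler_norm K; have := ler_norm (- E t0); rewrite normrN => *.
  have : M0 * (E t - E t0) <= M0 * (`|K| + `|E t0|) by rewrite ler_wpM2l//; lra.
  lra.
- move=> s t t0s st; have := decr s t t0s st; have := ndC s t t0s st.
  have := ndE s t t0s st => Est Cst.
  have : M0 * (E t - E s) <= (M0 + `|Z t0| + `|C t0| + M0 * (`|K| + `|E t0|)) * (E t - E s).
    rewrite ler_wpM2r ?subr_ge0// -!addrA lerDl !addr_ge0//.
  lra.
Qed.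

(** [E] is nondecreasing and bounded, so its increments beyond a late time are negligible. Once [Z]
    is small at one such time, it can no longer grow back. *)
Lemma cvg0_of_frequently_small (t0 K M : R) (Z eta E : R -> R) :
  (forall t, t0 <= t -> 0 <= Z t) ->
  (forall t, t0 <= t -> 0 <= eta t) ->
  (forall t, t0 <= t -> is_derive t 1 E (eta t)) ->
  (forall t, t0 <= t -> E t <= K) ->
  (forall s t, t0 <= s -> s <= t -> Z t <= Z s + M * (E t - E s)) ->
  (forall rho T : R, 0 < rho -> t0 <= T -> exists2 s, T <= s & Z s <= rho) ->
  Z t @[t --> +oo] --> 0.
Proof.
move=> Z0 eta0 dE EK decr freq.
have ndE := @nonneg_derive1_le t0 eta E eta0 dE.
apply/cvgrPdist_le => /= eps eps0.
pose A := E @` [set t | t0 <= t].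
have supA : has_sup A.
  by split; [exists (E t0), t0 => //=|exists K => _ [t /= t0t <-]; exact: EK].
(* Chosen so that [(1 + |M|) * d = eps / 2]; no sign of [M] is assumed. *)
pose d := eps / 2 / (1 + `|M|).
have d0 : 0 < d by rewrite /d !divr_gt0// ltr_pwDl.
have [_ [T /= t0T <-] ET] := sup_adherent d0 supA.
have [s Ts Zs] := freq (eps / 2) T (divr_gt0 eps0 (ltr0n _ 2)) t0T.
near=> t.
have st : s <= t by near: t; apply: nbhs_pinfty_ge; rewrite num_real.
have t0s := le_trans t0T Ts; have t0t := le_trans t0s st.
rewrite sub0r normrN ger0_norm ?Z0//.
apply: (le_trans (decr s t t0s st)).
have Esup : E t <= sup A by apply: (ub_le_sup supA.2); exists t.
have ETs := ndE T s t0T Ts; have Est := ndE s t t0s st.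
have : M * (E t - E s) <= (1 + `|M|) * d.
  have := ler_norm M; have := normr_ge0 M; nra.
rewrite /d [(1 + _) * _]mulrC divfK; last by rewrite gt_eqF// ltr_pwDl.
lra.
Unshelve. all: by end_near. Qed.

(** The function [q - Phi + c * ln] is nonincreasing, whereas [q - Phi] is bounded below and the
    logarithm is unbounded. *)
Lemma not_bounded_below_of_log_decay (T c B K : R) (q q' phi Phi : R -> R) :
  0 < T -> 0 < c ->
  (forall t, T <= t -> is_derive t 1 q (q' t)) ->
  (forall t, T <= t -> is_derive t 1 Phi (phi t)) ->
  (forall t, T <= t -> q' t <= - c * t^-1 + phi t) ->
  (forall t, T <= t -> Phi t <= K) ->
  (forall t, T <= t -> B <= q t) -> False.
Proof.
move=> T0 c0 dq dPhi q'le PhiK Bq.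
have dln t : T <= t -> is_derive t 1 (@ln R) t^-1.
  by move=> Tt; apply: is_derive1_ln; exact: lt_le_trans Tt.
pose h t := q t - Phi t + c * @ln R t.
have dh t : T <= t -> is_derive t 1 h (q' t - phi t + c * t^-1).
  move=> Tt; have := dq t Tt; have := dPhi t Tt; have := dln t Tt.
  move=> d1 d2 d3.
  exact: is_derive1D (is_derive1B d3 d2) (is_derive1Z c d1).
have hle t : T <= t -> h t <= h T.
  move=> Tt; apply: (@ler0_is_derive1_le T h (fun t => q' t - phi t + c * t^-1)) _ Tt => //.
  - by move=> r Tr; exact: is_derive1_continuous (dh r Tr).
  - by move=> r /ltW; exact: dh.
  - by move=> r /ltW/q'le; lra.
(* The contradiction is read off at time [expR L]: the first entry puts it after [T], the second
   makes [c * L] exceed the permitted bound [h T - B + K] by at least 1. *)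
pose L := Num.max (@ln R T) ((h T - B + K + 1) / c).
have TL : T <= expR L by rewrite -[leLHS]lnK ?posrE// ler_expR le_max lexx.
have := hle _ TL; rewrite /h expRK => /(le_trans _) hL.
have : h T - B + K + 1 <= c * L by rewrite mulrC -ler_pdivrMr// le_max lexx orbT.
have := PhiK _ TL; have := Bq _ TL; have := hle _ TL.
rewrite {1}/h expRK; lra.
Qed.

End half_line.

(** * Inner products: algebra, continuity, product rule, gradients of convex functions *)

Section inner_product.
Context {R : realType} {H : normedModType R} {inner : H -> H -> R}.
Hypothesis hinner : is_inner_product inner.
Implicit Types (x y z : H) (a : R).

Lemma innerC x y : inner x y = inner y x.
Proof. by have [] := hinner. Qed.

Lemma inner_linearl a x y z : inner (a *: x + y) z = a * inner x z + inner y z.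
Proof. by have [] := hinner. Qed.

Lemma innerxx x : inner x x = `|x| ^+ 2.
Proof. by have [] := hinner. Qed.

Lemma innerDl x y z : inner (x + y) z = inner x z + inner y z.
Proof. by have := inner_linearl 1 x y z; rewrite scale1r mul1r. Qed.

Lemma inner0l z : inner 0 z = 0.
Proof. by have := innerDl 0 0 z; rewrite addr0; lra. Qed.

Lemma innerZl a x z : inner (a *: x) z = a * inner x z.
Proof. by have := inner_linearl a x 0 z; rewrite addr0 inner0l addr0. Qed.

Lemma innerNl x z : inner (- x) z = - inner x z.
Proof. by rewrite -scaleN1r innerZl mulN1r. Qed.

Lemma innerBl x y z : inner (x - y) z = inner x z - inner y z.
Proof. by rewrite innerDl innerNl. Qed.

Lemma innerDr x y z : inner z (x + y) = inner z x + inner z y.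
Proof. by rewrite innerC innerDl !(innerC z). Qed.

Lemma innerZr a x z : inner z (a *: x) = a * inner z x.
Proof. by rewrite innerC innerZl innerC. Qed.

Lemma innerNr x z : inner z (- x) = - inner z x.
Proof. by rewrite innerC innerNl innerC. Qed.

Lemma innerBr x y z : inner z (x - y) = inner z x - inner z y.
Proof. by rewrite innerDr innerNr. Qed.

(** Cauchy-Schwarz: the squared norm of [|y| x - |x| y] equals [2 |x| |y| (|x| |y| - inner x y)]. *)
Lemma inner_le_norm x y : inner x y <= `|x| * `|y|.
Proof.
have [->|x0] := eqVneq x 0; first by rewrite inner0l normr0 mul0r.
have [->|y0] := eqVneq y 0; first by rewrite innerC inner0l normr0 mulr0.
have nx : 0 < `|x| by rewrite normr_gt0.
have ny : 0 < `|y| by rewrite normr_gt0.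
have : 0 <= inner (`|y| *: x - `|x| *: y) (`|y| *: x - `|x| *: y).
  by rewrite innerxx sqr_ge0.
rewrite !(innerBl, innerBr, innerZl, innerZr) !innerxx (innerC y x) => h.
have {h} : 0 <= (2 * `|x| * `|y|) * (`|x| * `|y| - inner x y) by lra.
by rewrite pmulr_rge0 ?subr_ge0// !mulr_gt0.
Qed.

Lemma inner_ge_norm x y : - (`|x| * `|y|) <= inner x y.
Proof. by have := inner_le_norm (- x) y; rewrite normrN innerNl; lra. Qed.

(** Expresses the inner product through norms alone, so that its continuity follows from that of the
    norm. *)
Lemma inner_polarization x y : inner x y = 4^-1 * (`|x + y| ^+ 2 - `|x - y| ^+ 2).
Proof.
by rewrite -!innerxx !(innerDl, innerDr, innerNl, innerNr) (innerC y x); field.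
Qed.

Lemma norm_sqrD_le x y : `|x + y| ^+ 2 <= 2 * `|x| ^+ 2 + 2 * `|y| ^+ 2.
Proof.
have := sqr_ge0 `|x - y|; rewrite -!innerxx.
by rewrite !(innerBl, innerBr, innerDl, innerDr) (innerC y x); lra.
Qed.

Lemma cvg_inner {T : Type} (F : set_system T) {FF : Filter F} (f g : T -> H) x y :
  f @ F --> x -> g @ F --> y -> inner (f t) (g t) @[t --> F] --> inner x y.
Proof.
move=> fx gy; rewrite inner_polarization.
under eq_cvg do rewrite inner_polarization.
apply: cvgMl_tmp; apply: cvgB; rewrite !expr2; apply: cvgM; apply: cvg_norm;
  by [exact: cvgD|exact: cvgB].
Qed.

Lemma is_derive1_inner (f g : R -> H) (t : R) (a b : H) :
  is_derive t 1 f a -> is_derive t 1 g b ->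
  is_derive t 1 (fun s => inner (f s) (g s)) (inner (f t) b + inner a (g t)).
Proof.
move=> df dg.
have cg := is_derive1_continuous dg.
case: df => df df'; case: dg => dg dg'.
suff h : h^-1 *: (inner (f (h *: 1 + t)) (g (h *: 1 + t)) - inner (f t) (g t)) @[h --> 0^'] -->
    inner (f t) b + inner a (g t).
  by apply: DeriveDef; [apply/cvg_ex; exists (inner (f t) b + inner a (g t)) | exact/cvg_lim].
have E h : h^-1 *: (inner (f (h *: 1 + t)) (g (h *: 1 + t)) - inner (f t) (g t)) =
    inner (f t) (h^-1 *: (g (h *: 1 + t) - g t)) +
    inner (h^-1 *: (f (h *: 1 + t) - f t)) (g (h *: 1 + t)).
  by rewrite !(innerZl, innerZr, innerBl, innerBr) -!mulrDr; congr (_ * _); ring.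
under eq_cvg do rewrite E.
apply: cvgD.
  apply: cvg_inner; first exact: cvg_cst.
  by rewrite -dg'; exact: dg.
apply: cvg_inner; first by rewrite -df'; exact: df.
apply: (@cvg_comp _ _ _ (fun h => h *: 1 + t) g _ (nbhs t)); last exact: cg.
apply: cvg_within_filter.
have : (h *: 1 + t) @[h --> (0 : R)] --> (0 *: 1 + t).
  by apply: cvgD; [apply: cvgZr_tmp; exact: cvg_id|exact: cvg_cst].
by rewrite scale0r add0r.
Qed.

Lemma is_derive1_innerr (f : R -> H) (z : H) (t : R) (a : H) :
  is_derive t 1 f a -> is_derive t 1 (fun s => inner (f s) z) (inner a z).
Proof.
move=> df; have := is_derive1_inner df (is_derive_cst z t 1).
by rewrite innerC inner0l add0r.
Qed.

(** For [0 < h <= 1] convexity bounds the difference quotient at [y] in the direction [z - y] by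
    [f z - f y]; let [h] tend to 0 from the right. *)
Lemma convex_gradient_le (f : H -> R) (gradf : H -> H) :
  is_gradient inner f gradf -> convex_fun f ->
  forall y z, f y + inner (gradf y) (z - y) <= f z.
Proof.
move=> gf cf y z; have [dfy dE] := gf y.
have dv : derivable f y (z - y) by exact: diff_derivable.
have eq : 'D_(z - y) f y = inner (gradf y) (z - y) by rewrite deriveE// dE.
rewrite -lerBrDl -eq.
have dvr : h^-1 *: (f (h *: (z - y) + y) - f y) @[h --> 0^'+] --> 'D_(z - y) f y.
  exact: cvg_dnbhs_at_right dv.
apply: (cvgr_to_le dvr); near=> h.
have h0 : 0 < h by [].
have h1 : h <= 1.
  by near: h; apply: nbhs_right_le.
rewrite /= ler_pdivrMl//.
have := cf z y h; rewrite (ltW h0) h1 => /(_ isT).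
have -> : h *: z + (1 - h) *: y = h *: (z - y) + y.
  by rewrite scalerBl scale1r scalerBr -addrA; congr (_ + _); rewrite addrC.
by rewrite /=; lra.
Unshelve. all: by end_near. Qed.

Lemma convex_gradient_monotone (f : H -> R) (gradf : H -> H) :
  is_gradient inner f gradf -> convex_fun f ->
  forall y z, 0 <= inner (gradf y - gradf z) (y - z).
Proof.
move=> gf cf y z.
have := convex_gradient_le gf cf y z; have := convex_gradient_le gf cf z y.
by rewrite innerBl !innerBr; lra.
Qed.

(** The inner product of the two difference quotients is a square times a nonnegative number. For
    [g = gradf x] this plays the part of the positivity of the Hessian. *)
Lemma monotone_derive1_ge0 (g x : R -> H) (t : R) (a b : H) :
  (forall s r, 0 <= inner (g s - g r) (x s - x r)) ->
  is_derive t 1 g a -> is_derive t 1 x b -> 0 <= inner a b.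
Proof.
move=> mono [dg dg'] [dx dx'].
have h : inner (h^-1 *: (g (h *: 1 + t) - g t)) (h^-1 *: (x (h *: 1 + t) - x t))
    @[h --> 0^'] --> inner a b.
  by rewrite -dg' -dx'; exact: cvg_inner dg dx.
apply: (cvgr_to_ge h); near=> r.
by rewrite innerZl innerZr mulrA mulr_ge0// -expr2 sqr_ge0.
Unshelve. all: by end_near. Qed.

End inner_product.

Lemma continuous_maxl {R : realType} (t0 : R) : continuous (Num.max t0).
Proof.
move=> t; apply: (@continuous_max R R (cst t0) id t); first exact: cvg_cst.
exact: cvg_id.
Qed.

Lemma is_derive1_inv {R : realType} (t : R) : t != 0 ->
  is_derive t 1 (fun s : R => s^-1) (- (t^-1 * t^-1)).
Proof.
move=> t0; have := @is_deriveV R id t 1 1 t0 (is_derive_id t 1).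
by rewrite /= [_ *: _]mulr1 -exprVn expr2.
Qed.

(** * Lyapunov analysis of the trajectory *)

Section energy.
Context {R : realType} {H : normedModType R} (inner : H -> H -> R).
Hypothesis hinner : is_inner_product inner.
Variables (t0 alpha beta m K : R) (f : H -> R).
Variables (x v a g eps : R -> H) (F eta E : R -> R).
Hypotheses (t0_gt0 : 0 < t0) (alpha_gt0 : 0 < alpha) (beta_gt0 : 0 < beta).
Hypotheses (cx : continuous x) (cv : continuous v) (cg : continuous g).
Hypothesis cF : continuous F.
Hypothesis dx : forall t, t0 < t -> is_derive t 1 x (v t).
Hypothesis dv : forall t, t0 < t -> is_derive t 1 v (a t).
Hypothesis dF : forall t, t0 < t -> is_derive t 1 F (inner (g t) (v t)).
Let p t := v t + beta *: g t.
Let p' t := - ((alpha / t) *: v t) - g t - eps t.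
Hypothesis dp : forall t, t0 < t -> is_derive t 1 p (p' t).
(** As [p' = a + beta g'], this is how [<g', v> >= 0] enters. *)
Hypothesis a_v_le : forall t, t0 < t -> inner (a t) (v t) <= inner (p' t) (v t).
Hypothesis Fconv : forall t z, F t + inner (g t) (z - x t) <= f z.
Hypothesis Fm : forall t, m <= F t.
Hypothesis minf : forall rho, 0 < rho -> exists z, f z < m + rho.
Hypothesis eps_eta : forall t, `|eps t| <= eta t.
Hypothesis dE : forall t, t0 <= t -> is_derive t 1 E (eta t).
Hypothesis EK : forall t, t0 <= t -> E t <= K.

Let gt0 t : t0 <= t -> 0 < t. Proof. exact: lt_le_trans. Qed.

Let eta_ge0 t : 0 <= eta t. Proof. exact: le_trans (eps_eta t). Qed.

Let cp : continuous p.
Proof.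
move=> t; rewrite /continuous_at /p; apply: cvgD; first exact: cv.
by apply: cvgZl_tmp; exact: cg.
Qed.

Let c_inner (h : R -> H) : continuous h -> continuous (fun t => inner (h t) (h t)).
Proof. by move=> ch t; apply: (cvg_inner hinner); exact: ch. Qed.

Let cVt t : t0 <= t -> {for t, continuous (fun s : R => s^-1)}.
Proof. by move=> t0t; apply: inv_continuous; rewrite gt_eqF// gt0. Qed.

Let Z t := 2^-1 * inner (v t) (v t) + (F t - m).
Let Z' t := inner (a t) (v t) + inner (g t) (v t).

(** The weight [1 + alpha * beta / t] is the one for which the terms in [<g, v>] cancel in [W']. *)
Let W t := 2^-1 * inner (p t) (p t) + (1 + alpha * beta * t^-1) * (F t - m).
Let W' t := inner (p' t) (p t) + ((1 + alpha * beta * t^-1) * inner (g t) (v t)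
  - (F t - m) * (alpha * beta * (t^-1 * t^-1))).

(** The dissipation rate of [W]. Replacing [t] by [Num.max t0 t] keeps it continuous on the whole
    line, as required to take a primitive. *)
Let c t := alpha * ((Num.max t0 t)^-1 * inner (v t) (v t)) + beta * inner (g t) (g t).

Let cc : continuous c.
Proof.
move=> t; rewrite /continuous_at /c; apply: cvgD; apply: cvgMl_tmp; last exact: c_inner.
apply: cvgM; last exact: c_inner.
apply: cvgV; first by rewrite gt_eqF// lt_max t0_gt0.
exact: continuous_maxl.
Qed.

Let cE t : t0 <= t -> c t = alpha * (t^-1 * inner (v t) (v t)) + beta * inner (g t) (g t).
Proof. by move=> t0t; rewrite /c max_r. Qed.

Let c_ge0 t : 0 <= c t.
Proof.
rewrite /c !innerxx// addr_ge0// !mulr_ge0 ?sqr_ge0// ?ltW//.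
by rewrite invr_gt0 lt_max t0_gt0.
Qed.

Let Z_ge t : 2^-1 * `|v t| ^+ 2 <= Z t.
Proof. by rewrite /Z innerxx// lerDl subr_ge0. Qed.

Let W_ge t : t0 <= t -> 2^-1 * `|p t| ^+ 2 <= W t /\ F t - m <= W t.
Proof.
move=> t0t; rewrite /W innerxx//; have := Fm t; have := sqr_ge0 `|p t|.
have : 0 < alpha * beta * t^-1 by rewrite !mulr_gt0// invr_gt0 gt0.
by move=> *; split; nra.
Qed.

Let dZ t : t0 < t -> is_derive t 1 Z (Z' t).
Proof.
move=> t0t.
have := is_derive1D (is_derive1Z 2^-1 (is_derive1_inner hinner (dv t0t) (dv t0t)))
  (is_derive1Dc (- m) (dF t0t)).
rewrite (innerC hinner (v t)) => h.
have -> : Z = (fun s => 2^-1 *: inner (v s) (v s) + (- m + F s)).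
  by apply/funext => s; rewrite /Z [- m + _]addrC.
apply: (is_derive_eq h).
by rewrite /Z' /GRing.scale/=; congr (_ + _); field.
Qed.

Let dW t : t0 < t -> is_derive t 1 W (W' t).
Proof.
move=> t0t; have tn0 : t != 0 by rewrite gt_eqF// gt0// ltW.
have := is_derive1D (is_derive1Z 2^-1 (is_derive1_inner hinner (dp t0t) (dp t0t)))
  (is_derive1M (is_derive1Dc (1 : R) (is_derive1Z (alpha * beta) (is_derive1_inv tn0)))
    (is_derive1Dc (- m) (dF t0t))).
rewrite (innerC hinner (p t)) => h.
have -> : W = (fun s => 2^-1 *: inner (p s) (p s)
    + (1 + alpha * beta *: s^-1) * (- m + F s)).
  by apply/funext => s; rewrite /W [- m + _]addrC.
apply: (is_derive_eq h).
by rewrite /W' /GRing.scale/=; field.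
Qed.

(** The [- 0] is the dissipation term of [lyapunov_bounded], here zero. The last term comes from
    [|v| <= (1 + |v|^2) / 2 <= 1 + Z]. *)
Let Z'_le t : t0 < t -> Z' t <= - 0 + (1 + Z t) * eta t.
Proof.
move=> t0t; apply: (le_trans (lerD (a_v_le t0t) (lexx _))).
rewrite /p' !(innerBl hinner, innerNl hinner, innerZl hinner) innerxx//.
have h1 := inner_ge_norm hinner (eps t) (v t); have h2 := Z_ge t.
have h3 : 0 <= alpha / t * `|v t| ^+ 2.
  by rewrite mulr_ge0 ?sqr_ge0// ltW// divr_gt0// gt0// ltW.
have h4 : `|eps t| * `|v t| <= (1 + Z t) * eta t.
  rewrite mulrC ler_pM//; have := sqr_ge0 (`|v t| - 1); rewrite sqrrB1; nra.
lra.
Qed.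

Let W'_le t : t0 < t -> W' t <= - c t + (1 + W t) * eta t.
Proof.
move=> t0t; rewrite (cE (ltW t0t)).
have h1 := inner_ge_norm hinner (eps t) (p t); have [h2 _] := W_ge (ltW t0t).
have h4 : `|eps t| * `|p t| <= (1 + W t) * eta t.
  rewrite mulrC ler_pM//; have := sqr_ge0 (`|p t| - 1); rewrite sqrrB1; nra.
have h5 : 0 <= (F t - m) * (alpha * beta * (t^-1 * t^-1)).
  by rewrite mulr_ge0 ?subr_ge0 ?Fm// ltW// !mulr_gt0// invr_gt0 gt0// ltW.
have -> : W' t = - (alpha * (t^-1 * inner (v t) (v t)) + beta * inner (g t) (g t))
     - inner (eps t) (p t) - (F t - m) * (alpha * beta * (t^-1 * t^-1)).
  rewrite /W' /p' !(innerBl hinner, innerNl hinner, innerZl hinner).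
  rewrite /p !(innerDr hinner, innerZr hinner) (innerC hinner (v t) (g t)).
  ring.
lra.
Qed.

Lemma energy_bounded : exists M C, [/\ forall t, t0 <= t -> is_derive t 1 C (c t),
    forall t, t0 <= t -> [/\ `|v t| <= M, W t <= M & C t <= M],
    forall s t, t0 <= s -> s <= t -> Z t <= Z s + M * (E t - E s) &
    forall s t, t0 <= s -> s <= t -> W t <= W s + M * (E t - E s)].
Proof.
have ndE := nonneg_derive1_le (fun t _ => eta_ge0 t) dE.
have [C dC] := continuous_primitive t0 cc.
have [M1 [Z1 _ Z3]] : exists M, [/\ forall t, t0 <= t -> Z t <= M,
    forall t, t0 <= t -> (cst 0 : R -> R) t <= M &
    forall s t, t0 <= s -> s <= t -> Z t <= Z s + M * (E t - E s)].
  apply: (@lyapunov_bounded R t0 K Z Z' (cst 0) eta (cst 0) E) => //.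
  - move=> t t0t; rewrite /prop_for /continuous_at /Z; apply: cvgD; last first.
      by apply: cvgB; [exact: cF|exact: cvg_cst].
    by apply: cvgMl_tmp; exact: c_inner.
  - move=> t t0t; split=> //; apply: le_trans (Z_ge t).
    by rewrite mulr_ge0// sqr_ge0.
have [M2 [W1 W2 W3]] : exists M, [/\ forall t, t0 <= t -> W t <= M,
    forall t, t0 <= t -> C t <= M &
    forall s t, t0 <= s -> s <= t -> W t <= W s + M * (E t - E s)].
  apply: (@lyapunov_bounded R t0 K W W' c eta C E) => //.
  - move=> t t0t; rewrite /prop_for /continuous_at /W; apply: cvgD.
      by apply: cvgMl_tmp; exact: c_inner.
    apply: cvgM; last by apply: cvgB; [exact: cF|exact: cvg_cst].
    by apply: cvgD; [exact: cvg_cst|apply: cvgMl_tmp; exact: cVt].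
  - move=> t t0t; split=> //; have [+ _] := W_ge t0t; apply: le_trans.
    by rewrite mulr_ge0// sqr_ge0.
(* The 1 leaves room for [|v| <= |v|^2 / 2 + 1 / 2 <= Z + 1 / 2]. *)
exists (`|M1| + `|M2| + 1), C; split=> //.
- move=> t t0t; have := Z1 t t0t; have := W1 t t0t; have := W2 t t0t.
  have := Z_ge t; have := ler_norm M1; have := ler_norm M2.
  have := normr_ge0 M1; have := normr_ge0 M2; have := normr_ge0 (v t).
  have := sqr_ge0 (`|v t| - 1); rewrite sqrrB1 => *; split; lra.
- move=> s t t0s st; apply: (le_trans (Z3 s t t0s st)); rewrite lerD2l ler_wpM2r//.
    by rewrite subr_ge0 ndE.
  by have := ler_norm M1; have := normr_ge0 M2; lra.
- move=> s t t0s st; apply: (le_trans (W3 s t t0s st)); rewrite lerD2l ler_wpM2r//.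
    by rewrite subr_ge0 ndE.
  by have := ler_norm M2; have := normr_ge0 M1; lra.
Qed.

(** Pairing [x] with the fixed vector [k = x t - x t0] reduces the vector estimate to a scalar one:
    [<x s, k> - M |k| s] is nonincreasing in [s]. It keeps [|x t - z| / t] bounded even when the
    trajectory is unbounded. *)
Let growth (M : R) : (forall t, t0 <= t -> `|v t| <= M) ->
  forall t, t0 <= t -> `|x t - x t0| <= M * (t - t0).
Proof.
move=> vM t t0t; set k := x t - x t0.
have M0 : 0 <= M by apply: le_trans (vM t0 _).
have [->|k0] := eqVneq k 0; first by rewrite normr0 mulr_ge0// subr_ge0.
have kgt0 : 0 < `|k| by rewrite normr_gt0.
have : inner (x t) k - M * `|k| * t <= inner (x t0) k - M * `|k| * t0.
  apply: (@ler0_is_derive1_le R t0 (fun s => inner (x s) k - M * `|k| * s)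
    (fun s => inner (v s) k - M * `|k| *: 1)) _ t0t => //.
  - move=> s _; rewrite /prop_for /continuous_at; apply: cvgB.
      by apply: (cvg_inner hinner); [exact: cx|exact: cvg_cst].
    by apply: cvgMl_tmp; exact: cvg_id.
  - move=> s t0s.
    exact: is_derive1B (is_derive1_innerr hinner k (dx t0s))
      (is_derive1Z (M * `|k|) (is_derive_id s 1)).
  - move=> s t0s; rewrite [_ *: _]mulr1 subr_le0.
    by apply: (le_trans (inner_le_norm hinner _ _)); rewrite ler_wpM2r// vM// ltW.
have := innerxx hinner k; rewrite {1}/k innerBl// => Ek hk.
rewrite -(ler_pM2r kgt0) -expr2 -Ek; lra.
Qed.

Let norm_p_sqr_le t : `|p t| ^+ 2 <= 2 * `|v t| ^+ 2 + 2 * beta ^+ 2 * `|g t| ^+ 2.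
Proof.
apply: (le_trans (norm_sqrD_le hinner _ _)).
by rewrite normrZ exprMn (gtr0_norm beta_gt0); lra.
Qed.

Let W_frequently_small (M : R) (C : R -> R) :
  (forall t, t0 <= t -> is_derive t 1 C (c t)) ->
  (forall t, t0 <= t -> [/\ `|v t| <= M, W t <= M & C t <= M]) ->
  forall rho T : R, 0 < rho -> t0 <= T -> exists2 s, T <= s & W s <= rho.
Proof.
move=> dC bnd rho T rho0 t0T; apply: contrapT => /forall2NP nW.
have {}nW s : T <= s -> rho < W s by move=> Ts; have [//|/negP] := nW s; rewrite -ltNge.
have M0 : 0 <= M by have [vM _ _] := bnd t0 (lexx _); exact: le_trans vM.
(* An almost-minimizer takes the place of a minimizer, which may not exist. *)
have [z fz] := minf (divr_gt0 rho0 (ltr0n _ 2)).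
pose C1 := `|x t0 - z| / t0 + M.
have C10 : 0 <= C1 by rewrite addr_ge0// divr_ge0// ltW.
have xz t : t0 <= t -> `|x t - z| * t^-1 <= C1.
  move=> t0t; rewrite ler_pdivrMr ?gt0//.
  have -> : x t - z = (x t - x t0) + (x t0 - z) by rewrite addrA subrK.
  apply: (le_trans (ler_normD _ _)).
  have vM s : t0 <= s -> `|v s| <= M by move=> /bnd[].
  have := growth vM t0t.
  have : `|x t0 - z| <= `|x t0 - z| / t0 * t.
    by rewrite -mulrA ler_peMr// mulrC ler_pdivlMr// mul1r.
  have : 0 <= M * t0 by rewrite mulr_ge0// ltW.
  rewrite /C1 mulrDl; lra.
(* [A1] and [A2] collect the coefficients of [|p|^2] and [|v|^2] in the estimate of [q']; [B1] and
   [B2] then convert these squares, divided by [t], into multiples of [c]. *)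
pose A1 := 1 + 4 * C1 ^+ 2 / rho.
pose A2 := 2^-1 + 4 * (alpha * C1) ^+ 2 / rho.
have A10 : 0 <= A1 by rewrite addr_ge0// divr_ge0 ?(ltW rho0)// mulr_ge0// sqr_ge0.
have A20 : 0 <= A2 by rewrite addr_ge0// divr_ge0 ?(ltW rho0)// mulr_ge0// sqr_ge0.
pose B1 := (2 * A1 + A2) / alpha.
pose B2 := 2 * A1 * beta / t0.
have B10 : 0 <= B1 by rewrite divr_ge0 ?(ltW alpha_gt0)// addr_ge0// mulr_ge0.
have B20 : 0 <= B2 by rewrite divr_ge0 ?(ltW t0_gt0)// !mulr_ge0 ?(ltW beta_gt0).
(* From this time on [alpha * beta * M / t <= rho / 8], so the weight in [W] costs at most
   [rho / 8]. *)
pose T1 := Num.max T (8 * (alpha * beta * M) / rho) + 1.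
have TT1 : T < T1 by rewrite ltr_pwDr// le_max lexx.
have t0T1 : t0 < T1 by exact: le_lt_trans TT1.
pose q t := inner (p t) (x t - z) * t^-1.
pose q' t := inner (p t) (x t - z) * (- (t^-1 * t^-1))
  + t^-1 * (inner (p t) (v t) + inner (p' t) (x t - z)).
apply: (@not_bounded_below_of_log_decay R T1 (rho / 4) (- ((1 + 2 * M) * C1))
  ((B1 + B2) * M + C1 * K) q q' (fun t => (B1 + B2) * c t + C1 * eta t)
  (fun t => (B1 + B2) * C t + C1 * E t)).
- by rewrite gt0// ltW.
- by rewrite divr_gt0.
- move=> t T1t; have t0t := lt_le_trans t0T1 T1t.
  have dxz : is_derive t 1 (fun s => x s - z) (v t).
    by have := is_derive1B (dx t0t) (is_derive_cst z t 1); rewrite subr0.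
  have tn0 : t != 0 by rewrite gt_eqF// gt0// ltW.
  exact: is_derive1M (is_derive1_inner hinner (dp t0t) dxz) (is_derive1_inv tn0).
- move=> t T1t; have t0t := ltW (lt_le_trans t0T1 T1t).
  exact: is_derive1D (is_derive1Z _ (dC t t0t)) (is_derive1Z _ (dE t0t)).
- move=> t T1t; have t0t := ltW (lt_le_trans t0T1 T1t).
  have tgt0 := gt0 t0t; have i0 : 0 < t^-1 by rewrite invr_gt0.
  have xzt := xz t t0t.
  set i := t^-1 in i0 xzt *.
  have small : alpha * beta * i * (F t - m) <= rho / 8.
    have [_ Fm'] := W_ge t0t; have [_ WM _] := bnd t t0t.
    have h1 : alpha * beta * i * (F t - m) <= alpha * beta * i * M.
      by rewrite ler_wpM2l ?(le_trans Fm')// ltW// !mulr_gt0.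
    apply: (le_trans h1); rewrite mulrAC -ler_pdivlMr// /i invrK.
    have : 8 * (alpha * beta * M) / rho <= t.
      by apply: le_trans T1t; rewrite /T1 ltW// ltr_pwDr// le_max lexx orbT.
    by rewrite ler_pdivrMr//; lra.
  (* From [W > rho]: [F - m > 7 rho / 8 - |p|^2 / 2], whereas [f z - m < rho / 2]. *)
  have Fz : f z - F t <= - (3 * rho / 8) + 2^-1 * `|p t| ^+ 2.
    have := nW t (ltW (lt_le_trans TT1 T1t)); rewrite /W innerxx// -/i; lra.
  have conv := Fconv t z; rewrite -opprB innerNr// in conv.
  have e1 : inner (p t) (x t - z) * (- (i * i)) <= `|p t| * C1 * i.
    have h := inner_ge_norm hinner (p t) (x t - z).
    have h2 : `|p t| * (`|x t - z| * i) <= `|p t| * C1 by rewrite ler_wpM2l.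
    have h3 : - inner (p t) (x t - z) * i <= `|p t| * C1 by nra.
    have := ler_wpM2r (ltW i0) h3; lra.
  have e2 : inner (p t) (v t) <= 2^-1 * `|p t| ^+ 2 + 2^-1 * `|v t| ^+ 2.
    have := inner_le_norm hinner (p t) (v t).
    have := sqr_ge0 (`|p t| - `|v t|); rewrite sqrrB; lra.
  have e3 : - (alpha * i * inner (v t) (x t - z)) <= alpha * C1 * `|v t|.
    have h := inner_ge_norm hinner (v t) (x t - z).
    have h2 : `|v t| * (`|x t - z| * i) <= `|v t| * C1 by rewrite ler_wpM2l.
    have h3 : - inner (v t) (x t - z) * i <= `|v t| * C1 by nra.
    have := ler_wpM2l (ltW alpha_gt0) h3; lra.
  have e4 : - (i * inner (eps t) (x t - z)) <= C1 * eta t.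
    have h := inner_ge_norm hinner (eps t) (x t - z).
    have h2 : `|eps t| * (`|x t - z| * i) <= `|eps t| * C1 by rewrite ler_wpM2l.
    have h3 : `|eps t| * C1 <= eta t * C1 by rewrite ler_wpM2r.
    nra.
  (* Young's inequality, here and in [e6], weighted to cost [rho / 16] each; of the gain [3 rho / 8]
     there remains [rho / 4]. *)
  have e5 : C1 * `|p t| <= rho / 16 + 4 * C1 ^+ 2 / rho * `|p t| ^+ 2.
    have : 0 <= (rho / 4 - 2 * C1 * `|p t|) ^+ 2 / rho.
      by rewrite divr_ge0 ?sqr_ge0 ?(ltW rho0).
    have -> : (rho / 4 - 2 * C1 * `|p t|) ^+ 2 / rho =
       rho / 16 - C1 * `|p t| + 4 * C1 ^+ 2 / rho * `|p t| ^+ 2.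
      by field; rewrite gt_eqF.
    lra.
  have e6 : alpha * C1 * `|v t| <= rho / 16 + 4 * (alpha * C1) ^+ 2 / rho * `|v t| ^+ 2.
    have : 0 <= (rho / 4 - 2 * (alpha * C1) * `|v t|) ^+ 2 / rho.
      by rewrite divr_ge0 ?sqr_ge0 ?(ltW rho0).
    have -> : (rho / 4 - 2 * (alpha * C1) * `|v t|) ^+ 2 / rho =
       rho / 16 - alpha * C1 * `|v t| + 4 * (alpha * C1) ^+ 2 / rho * `|v t| ^+ 2.
      by field; rewrite gt_eqF.
    lra.
  have e7 : `|p t| ^+ 2 <= 2 * `|v t| ^+ 2 + 2 * beta ^+ 2 * `|g t| ^+ 2.
    exact: norm_p_sqr_le.
  have e8 : i * (A1 * `|p t| ^+ 2 + A2 * `|v t| ^+ 2) <= (B1 + B2) * c t.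
    rewrite cE// !innerxx// -/i.
    have h1 : A1 * `|p t| ^+ 2 <= A1 * (2 * `|v t| ^+ 2 + 2 * beta ^+ 2 * `|g t| ^+ 2).
      by rewrite ler_wpM2l.
    have h2 : i * (2 * A1 * beta ^+ 2 * `|g t| ^+ 2) <= B2 * (beta * `|g t| ^+ 2).
      have -> : B2 * (beta * `|g t| ^+ 2) = t0^-1 * (2 * A1 * beta ^+ 2 * `|g t| ^+ 2).
        by rewrite /B2; field; rewrite gt_eqF.
      apply: ler_wpM2r; first by rewrite mulr_ge0 ?sqr_ge0// mulr_ge0 ?sqr_ge0// mulr_ge0.
      by rewrite /i lef_pV2 ?posrE.
    have h3 : i * ((2 * A1 + A2) * `|v t| ^+ 2) = B1 * (alpha * (i * `|v t| ^+ 2)).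
      by rewrite /B1; field; rewrite gt_eqF.
    have h4 : 0 <= B1 * (beta * `|g t| ^+ 2).
      by apply: mulr_ge0 => //; rewrite mulr_ge0 ?sqr_ge0// ltW.
    have h5 : 0 <= B2 * (alpha * (i * `|v t| ^+ 2)).
      apply: mulr_ge0 => //; apply: mulr_ge0; first exact: ltW.
      by apply: mulr_ge0; rewrite ?sqr_ge0// ltW.
    have := ler_wpM2l (ltW i0) h1; lra.
  have -> : q' t = inner (p t) (x t - z) * - (i * i)
     + (i * (inner (p t) (v t) - alpha * i * inner (v t) (x t - z)
         - inner (g t) (x t - z)) - i * inner (eps t) (x t - z)).
    by rewrite /q' /p' !(innerBl hinner, innerNl hinner, innerZl hinner) -/i; ring.
  have : i * (inner (p t) (v t) - alpha * i * inner (v t) (x t - z)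
         - inner (g t) (x t - z)) <= i * (2^-1 * `|p t| ^+ 2 + 2^-1 * `|v t| ^+ 2 +
          (rho / 16 + 4 * (alpha * C1) ^+ 2 / rho * `|v t| ^+ 2) +
          (- (3 * rho / 8) + 2^-1 * `|p t| ^+ 2)).
    by rewrite (ler_wpM2l (ltW i0))//; lra.
  have := ler_wpM2l (ltW i0) e5; move: e8; rewrite /A1 /A2; lra.
- move=> t T1t; have t0t := ltW (lt_le_trans t0T1 T1t).
  have [_ _ CM] := bnd t t0t.
  by rewrite lerD// ler_wpM2l// ?EK// addr_ge0.
- move=> t T1t; have t0t := ltW (lt_le_trans t0T1 T1t).
  have [_ WM _] := bnd t t0t; have [pW _] := W_ge t0t.
  have pM : `|p t| <= 1 + 2 * M by have := sqr_ge0 (`|p t| - 1); rewrite sqrrB1; lra.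
  have h := inner_ge_norm hinner (p t) (x t - z).
  have i0 : 0 < t^-1 by rewrite invr_gt0 gt0.
  have := ler_wpM2r (ltW i0) h; apply: le_trans.
  by rewrite mulNr lerN2 -mulrA ler_pM// ?xz// mulr_ge0// (ltW i0).
Qed.

Let cvg_norm0_of_half_sqr_le (h : R -> H) (Y : R -> R) :
  (forall t, t0 <= t -> 2^-1 * `|h t| ^+ 2 <= Y t) ->
  Y t @[t --> +oo] --> 0 -> `|h t| @[t --> +oo] --> 0.
Proof.
move=> hY /cvgrPdist_lt Y0; apply/cvgrPdist_lt => /= d d0.
have d20 : 0 < 2^-1 * d ^+ 2 by rewrite mulr_gt0// exprn_gt0.
near=> t.
have t0t : t0 <= t by near: t; apply: nbhs_pinfty_ge; rewrite num_real.
have : `|0 - Y t| < 2^-1 * d ^+ 2 by near: t; exact: Y0.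
rewrite !sub0r !normrN normr_id => Yt.
have : `|h t| ^+ 2 < d ^+ 2 by have := hY t t0t; have := ler_norm (Y t); lra.
by rewrite ltr_sqr ?nnegrE// ltW.
Unshelve. all: by end_near. Qed.

Lemma energy_asymptotics : exists M,
  [/\ forall t, t0 <= t -> `|p t| <= M,
      (\int[lebesgue_measure]_(t in `[t0, +oo[)
        (alpha * (t^-1 * `|v t| ^+ 2) + beta * `|g t| ^+ 2)%:E < +oo)%E
    & [/\ `|p t| @[t --> +oo] --> 0, `|v t| @[t --> +oo] --> 0,
          `|g t| @[t --> +oo] --> 0 & F t @[t --> +oo] --> m]].
Proof.
have [M [C [dC bnd Zdecr Wdecr]]] := energy_bounded.
have W_ge0 t : t0 <= t -> 0 <= W t.
  by move=> t0t; have [_] := W_ge t0t; apply: le_trans; rewrite subr_ge0.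
have W0 : W t @[t --> +oo] --> 0.
  apply: (@cvg0_of_frequently_small R t0 K M W eta E) => //.
  exact: W_frequently_small dC bnd.
have p0 : `|p t| @[t --> +oo] --> 0.
  by apply: (cvg_norm0_of_half_sqr_le _ W0) => t /W_ge[].
have Fm0 : F t @[t --> +oo] --> m.
  apply/cvgrPdist_lt => /= d d0; move/cvgrPdist_lt : W0 => W0; near=> t.
  have t0t : t0 <= t by near: t; apply: nbhs_pinfty_ge; rewrite num_real.
  have : `|0 - W t| < d by near: t; exact: W0.
  rewrite sub0r normrN => Wt; rewrite distrC ger0_norm ?subr_ge0//.
  by have [_] := W_ge t0t; have := ler_norm (W t); lra.
have Z0 : Z t @[t --> +oo] --> 0.
  apply: (@cvg0_of_frequently_small R t0 K M Z eta E) => //.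
    by move=> t _; apply: le_trans (Z_ge t); rewrite mulr_ge0// sqr_ge0.
  move=> rho T rho0 t0T; apply: contrapT => /forall2NP nZ.
  have : \forall t \near +oo, F t - m < rho / 2.
    move/cvgrPdist_lt : Fm0 => /(_ _ (divr_gt0 rho0 (ltr0n _ 2))).
    apply: filterS => t /=; rewrite distrC; apply: le_lt_trans; exact: ler_norm.
  move=> [T1 [_ FT1]].
  pose T2 := Num.max T T1 + 1.
  have TT2 : T < T2 by rewrite ltr_pwDr// le_max lexx.
  have T1T2 : T1 < T2 by rewrite ltr_pwDr// le_max lexx orbT.
  have t0T2 : t0 <= T2 by rewrite ltW// (le_lt_trans t0T).
  (* Used with [q = 0]: as [Z > rho] and [F - m < rho / 2], one has [|v|^2 > rho], hence
     [c >= alpha * rho / t], and [C] would outgrow its bound [M]. *)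
  apply: (@not_bounded_below_of_log_decay R T2 (alpha * rho) 0 M (cst 0) (cst 0) c C) => //.
  - exact: gt0.
  - exact: mulr_gt0.
  - by move=> t T2t; apply: dC; exact: le_trans T2t.
  - move=> t T2t; have t0t := le_trans t0T2 T2t.
    have [|/negP] := nZ t; first by move=> /negP; rewrite (le_trans (ltW TT2)).
    rewrite -ltNge /Z => Zt; have /= Ft := FT1 t (lt_le_trans T1T2 T2t).
    rewrite cE//; have i0 : 0 < t^-1 by rewrite invr_gt0 gt0.
    have h1 : 0 <= beta * inner (g t) (g t) by rewrite innerxx// mulr_ge0 ?sqr_ge0// ltW.
    have h2 : rho * t^-1 <= t^-1 * inner (v t) (v t) by rewrite mulrC ler_pM2l//; lra.
    have := ler_wpM2l (ltW alpha_gt0) h2; rewrite /=; lra.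
  - by move=> t T2t; have [] := bnd t (le_trans t0T2 T2t).
have v0 : `|v t| @[t --> +oo] --> 0.
  by apply: (cvg_norm0_of_half_sqr_le _ Z0) => t _; exact: Z_ge.
exists (1 + 2 * M); split.
- move=> t t0t; have [_ WM _] := bnd t t0t; have [pW _] := W_ge t0t.
  by have := sqr_ge0 `|p t|; have := sqr_ge0 (`|p t| - 1); rewrite sqrrB1; lra.
- have : (\int[lebesgue_measure]_(t in `[t0, +oo[) (c t)%:E < +oo)%E.
    apply: (@primitive_bounded_integral_lty R t0 M c C) => //.
    + by move=> t _; exact: cc.
    + by move=> t t0t; have [] := bnd t t0t.
  congr (_ < _)%E; apply: eq_integral => t; rewrite inE/= in_itv/= andbT => t0t.
  by rewrite cE// !innerxx.
- split=> //.
  have h : beta^-1 * (`|p t| + `|v t|) @[t --> +oo] --> 0.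
    rewrite -[X in _ --> X](mulr0 beta^-1) -[X in _ * X](addr0 0).
    by apply: cvgMl_tmp; exact: cvgD.
  apply: (@squeeze_cvgr _ _ _ _ (cst 0) (fun t => beta^-1 * (`|p t| + `|v t|))) => //.
    near=> t; rewrite normr_ge0 /= ler_pdivlMl//.
    have -> : beta * `|g t| = `|p t - v t|.
      by rewrite /p addrC addKr normrZ gtr0_norm.
    exact: ler_normB.
  exact: cvg_cst.
Unshelve. all: by end_near. Qed.

End energy.

(** * From weak primitives to strong derivatives *)

Section weak_derivative.
Context {R : realType} {H : normedModType R} (inner : H -> H -> R).
Hypothesis hinner : is_inner_product inner.

(** The intermediate point is located by its distance to [s], so that increments of both signs are
    covered at once. *)
Lemma is_derive1_mean_value (t0 s t : R) (h h' : R -> R) :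
  (forall r, t0 < r -> is_derive r 1 h (h' r)) -> t0 < s -> t0 < t ->
  exists2 r, `|r - s| <= `|t - s| & h t - h s = h' r * (t - s).
Proof.
move=> dh.
have MV (a b : R) : t0 < a -> a <= b ->
    exists2 r, a <= r <= b & h b - h a = h' r * (b - a).
  move=> t0a ab; have [||r] := @MVT_segment R h h' a b ab.
  - by move=> r; rewrite in_itv/= => /andP[ar _]; apply: dh; exact: lt_trans ar.
  - apply: continuous_in_subspaceT => r; rewrite inE/= in_itv/= => /andP[ar _].
    by apply: is_derive1_continuous (dh r _); exact: lt_le_trans ar.
  by rewrite in_itv/= => rab E; exists r.
move=> t0s t0t; have [st|ts] := leP s t.
- have [r /andP[sr rt] E] := MV s t t0s st.
  by exists r => //; rewrite !ger0_norm ?subr_ge0// lerD2r.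
- have [r /andP[tr rs] E] := MV t s t0t (ltW ts).
  exists r; first by rewrite !ler0_norm ?subr_le0// ?(ltW ts)// lerN2 lerD2r.
  lra.
Qed.

(* Testing the difference quotient minus [p t] against itself turns the scalar mean
   value theorem into a norm estimate. *)
Lemma weak_is_derive1 (t0 t : R) (u p : R -> H) :
  (forall k s, t0 < s -> is_derive s 1 (fun r => inner (u r) k) (inner (p s) k)) ->
  t0 < t -> {for t, continuous p} -> is_derive t 1 u (p t).
Proof.
move=> du t0t cp.
suff h : h^-1 *: (u (h *: 1 + t) - u t) @[h --> 0^'] --> p t.
  by apply: DeriveDef; [apply/cvg_ex; exists (p t) | exact/cvg_lim].
apply/cvgrPdist_le => /= eps eps0.
move/cvgrPdist_le : cp => /(_ _ eps0) /nbhs_ballP[d /= d0 pd].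
near=> h.
have hn0 : h != 0 by near: h; exact: nbhs_dnbhs_neq.
have hd : `|h| < d.
  by near: h; apply: dnbhs0_lt.
have ht : `|h| < t - t0.
  by near: h; apply: dnbhs0_lt; rewrite subr_gt0.
have th : t0 < h + t by move: ht; rewrite ltr_norml => /andP[]; lra.
set k := p t - _.
have [r rt E] := is_derive1_mean_value (du k) t0t th.
have Ek : `|k| ^+ 2 = inner (p t - p r) k.
  rewrite -(innerxx hinner) {1}/k !innerBl//; congr (_ - _).
  rewrite innerZl// innerBl// [h *: 1]mulr1 E addrK mulrC mulfK//.
have pr : `|p t - p r| <= eps.
  apply: pd; rewrite /ball/= distrC; apply: le_lt_trans rt _.
  by rewrite addrK.
have [->|k0] := eqVneq k 0; first by rewrite normr0 ltW.
have kgt0 : 0 < `|k| by rewrite normr_gt0.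
rewrite -(ler_pM2r kgt0) -expr2 Ek.
by apply: (le_trans (inner_le_norm hinner _ _)); rewrite ler_wpM2r.
Unshelve. all: by end_near. Qed.

(** [y] is an integral of [p] in the weak sense, tested against each vector [k]. The scalar
    fundamental theorem of calculus gives the derivative of every pairing, and [weak_is_derive1]
    upgrades this to a derivative in norm. *)
Lemma is_derive1_of_weak_primitive (t0 t : R) (y p : R -> H) :
  continuous p ->
  (forall s, t0 <= s -> forall k, inner (y s) k =
     Rintegral lebesgue_measure `[t0, s] (fun r => inner (p r) k)) ->
  t0 < t -> is_derive t 1 y (p t).
Proof.
move=> cp yE t0t; apply: (@weak_is_derive1 t0 t y p _ t0t (cp t)) => k s t0s.
have ck : continuous (fun r => inner (p r) k).
  by move=> r; apply: (cvg_inner hinner); [exact: cp|exact: cvg_cst].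
have [||||dI EI] := @continuous_FTC1_closed R (fun r => inner (p r) k) t0 s (s + 1).
- by rewrite ltrDl.
- by apply: continuous_compact_integrable;
    [exact: segment_compact|exact: continuous_subspaceT].
- by [].
- exact: ck.
apply: near_eq_is_derive; last first.
  by apply: (DeriveDef dI); rewrite -derive1E.
near=> r; rewrite yE//.
by near: r; exact: lt_le_nbhsr.
Unshelve. all: by end_near. Qed.

End weak_derivative.

(* Precomposition with [Num.max t0] extends functions on [t0, +oo[ to continuous functions
   on the whole line without changing their derivatives on ]t0, +oo[. *)
Section clamp.
Context {R : realType} {V : normedModType R} (t0 : R).

Lemma continuous_comp_max (h : R -> V) :
  {within `[t0, +oo[, continuous h} -> continuous (fun t => h (Num.max t0 t)).
Proof.
move=> /subspace_continuousP ch t.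
have At s : `[t0, +oo[%classic (Num.max t0 s) by rewrite /= in_itv/= andbT le_max lexx.
apply: (@cvg_comp _ _ _ (Num.max t0) h _ (within `[t0, +oo[ (nbhs (Num.max t0 t)))).
  move=> P AP; rewrite /nbhs/=.
  have : nbhs t (Num.max t0 @^-1` [set y | `[t0, +oo[%classic y -> P y]).
    exact: (@continuous_maxl R t0 t _ AP).
  by apply: filterS => s; apply.
exact: ch.
Qed.

Lemma C1_on_ge_is_derive1 (h g : R -> V) t :
  C1_on_ge t0 h g -> t0 < t -> is_derive t 1 h (g t).
Proof.
by move=> [dh _ _] /dh[h1 <-]; rewrite derive1E; exact: derivableP.
Qed.

Lemma is_derive1_comp_max (h : R -> V) (t : R) (d : V) :
  t0 < t -> is_derive t 1 h d -> is_derive t 1 (fun s => h (Num.max t0 s)) d.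
Proof.
move=> t0t; apply: near_eq_is_derive; near=> s; rewrite max_r//.
by near: s; exact: lt_le_nbhsr.
Unshelve. all: by end_near. Qed.

End clamp.

(** [f] is compared only on the open half-line because [derive1] at [t0] depends on values to the
    left of [t0]; the point [t0] is negligible for the integral. *)
Lemma integral_lty_comparison {R : realType} (t0 k : R) (f h g : R -> R) :
  (forall t, t0 <= t -> {for t, continuous h}) ->
  (forall t, t0 <= t -> {for t, continuous g}) ->
  (forall t, t0 < t -> f t = h t) ->
  (forall t, t0 <= t -> 0 <= h t <= k * g t) ->
  (forall t, t0 <= t -> 0 <= g t) -> 0 <= k ->
  (\int[lebesgue_measure]_(t in `[t0, +oo[) (g t)%:E < +oo)%E ->
  (\int[lebesgue_measure]_(t in `[t0, +oo[) (f t)%:E < +oo)%E.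
Proof.
move=> ch cg fh hg g0 k0 gi.
have mo (q : R -> R) : (forall t, t0 <= t -> {for t, continuous q}) ->
    measurable_fun `]t0, +oo[ q.
  move=> cq; apply: open_continuous_measurable_fun => // t.
  by rewrite inE/= in_itv/= andbT => /ltW; exact: cq.
have mc (q : R -> R) : (forall t, t0 <= t -> {for t, continuous q}) ->
    measurable_fun `[t0, +oo[ q.
  by move=> /mo mq; exact/measurable_fun_itv_obnd_cbndP.
have mf : measurable_fun `]t0, +oo[ f.
  apply: eq_measurable_fun (mo _ ch) => t.
  by rewrite inE/= in_itv/= andbT => /fh.
rewrite -integral_itv_obnd_cbnd; last exact/measurable_EFinP.
have -> : (\int[lebesgue_measure]_(t in `]t0, +oo[) (f t)%:E =
    \int[lebesgue_measure]_(t in `]t0, +oo[) (h t)%:E)%E.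
  by apply: eq_integral => t; rewrite inE/= in_itv/= andbT => /fh ->.
rewrite integral_itv_obnd_cbnd; last by apply/measurable_EFinP; exact: mo.
apply: (@le_lt_trans _ _ (\int[lebesgue_measure]_(t in `[t0, +oo[) (k%:E * (g t)%:E))%E).
  apply: ge0_le_integral => //=.
  - by move=> t; rewrite in_itv/= andbT => /hg/andP[h0 _]; rewrite lee_fin.
  - by apply/measurable_EFinP; exact: mc.
  - by apply: measurable_funeM; apply/measurable_EFinP; exact: mc.
  - by move=> t; rewrite in_itv/= andbT => /hg/andP[_ hk]; rewrite -EFinM lee_fin.
rewrite ge0_integralZl_EFin//.
- by rewrite lte_mul_pinfty.
- by move=> t; rewrite /= in_itv/= andbT => /g0; rewrite lee_fin.
- by apply/measurable_EFinP; exact: mc.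
Qed.

(** * Application to the perturbed inertial system *)

Unset Implicit Arguments.

(** The vector integral defining [u] is expressed weakly in [hu], by scalar integrals against every
    [h]. *)
Theorem theorem4 (R : realType) (H : completeNormedModType R)
  (inner : H -> H -> R) (hinner : is_inner_product inner)
  (t0 : R) (ht0 : 0 < t0)
  (f : H -> R) (gradf : H -> H)
  (hfC2 : C2_with_gradient inner f gradf)
  (hfconv : convex_fun f)
  (hfbdd : exists m : R, forall y, m <= f y)
  (e e' : R -> H) (heC1 : C1_on_ge t0 e e')
  (he_int : (\int[lebesgue_measure]_(t in `[t0, +oo[) (`|e t|)%:E < +oo)%E)
  (he'_int : (\int[lebesgue_measure]_(t in `[t0, +oo[) (`|e' t|)%:E < +oo)%E)
  (alpha beta : R) (halpha : 0 < alpha) (hbeta : 0 < beta)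
  (x v a : R -> H) (hxC1 : C1_on_ge t0 x v) (hvC1 : C1_on_ge t0 v a)
  (hsol : forall t, t0 < t ->
     a t + (alpha / t) *: v t
       + beta *: derive1 (fun s => gradf (x s) + e s) t
       + (gradf (x t) + e t) = 0)
  (u : R -> H)
  (hu : forall t, t0 <= t -> forall h : H,
     inner (u t) h = inner (x t) h
       + beta * Rintegral lebesgue_measure `[t0, t] (fun s => inner (gradf (x s)) h)) :
  (* (i) *)
  (exists M : R, forall t, t0 < t -> `|derive1 u t| <= M)
  (* (ii) *)
  /\ [/\ (\int[lebesgue_measure]_(t in `[t0, +oo[)
            (t^-1 * `|derive1 x t| ^+ 2)%:E < +oo)%E,
         (\int[lebesgue_measure]_(t in `[t0, +oo[)
            (`|gradf (x t)| ^+ 2)%:E < +oo)%E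
       & (\int[lebesgue_measure]_(t in `[t0, +oo[)
            (t^-1 * `|derive1 u t| ^+ 2)%:E < +oo)%E]
  (* (iii) *)
  /\ [/\ `|derive1 u t| @[t --> +oo] --> 0,
         `|derive1 x t| @[t --> +oo] --> 0
       & `|gradf (x t)| @[t --> +oo] --> 0]
  (* (iv) *)
  /\ f (x t) @[t --> +oo] --> inf (range f).
Proof.
have [gf dgradf _] := hfC2.
have {}dx t : t0 < t -> is_derive t 1 x (v t).
  by move=> t0t; exact: (C1_on_ge_is_derive1 hxC1 t0t).
have {}dv t : t0 < t -> is_derive t 1 v (a t).
  by move=> t0t; exact: (C1_on_ge_is_derive1 hvC1 t0t).
have de t : t0 < t -> is_derive t 1 e (e' t).
  by move=> t0t; exact: (C1_on_ge_is_derive1 heC1 t0t).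
pose g t := gradf (x t).
pose g' t := derive1 g t.
have dg t : t0 < t -> is_derive t 1 g (g' t).
  move=> /dx dxt; rewrite /g' derive1E; apply: derivableP; apply/derivable1_diffP.
  apply: (@differentiable_comp _ _ _ _ x gradf); last exact: dgradf.
  by apply/derivable1_diffP; exact: ex_derive.
pose tau := Num.max t0.
have tauE t : t0 <= t -> tau t = t by move=> t0t; rewrite /tau max_r.
have cx : continuous (fun t => x (tau t)).
  by have [_ + _] := hxC1; exact: continuous_comp_max.
have cv : continuous (fun t => v (tau t)).
  by have [_ _ +] := hxC1; exact: continuous_comp_max.
have ce : continuous (fun t => e (tau t)).
  by have [_ + _] := heC1; exact: continuous_comp_max.
have ce' : continuous (fun t => e' (tau t)).
  by have [_ _ +] := heC1; exact: continuous_comp_max.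
have cg : continuous (fun t => g (tau t)).
  move=> t; apply: (@continuous_comp _ _ _ (fun t => x (tau t)) gradf); first exact: cx.
  exact/differentiable_continuous/dgradf.
have cF : continuous (fun t => f (x (tau t))).
  move=> t; apply: (@continuous_comp _ _ _ (fun t => x (tau t)) f); first exact: cx.
  by apply: differentiable_continuous; have [] := gf (x (tau t)).
have cn (h : R -> H) : continuous h -> continuous (fun t => `|h t|).
  by move=> ch t; apply: cvg_norm; exact: ch.
(* [E1 + beta * E2] will be the bounded primitive of [|e| + beta * |e'|], which dominates the
   perturbation [e + beta * e']. *)
have [E1 dE1] := continuous_primitive t0 (cn _ ce).
have [E2 dE2] := continuous_primitive t0 (cn _ ce').
have [K1 EK1] : exists K, forall t, t0 <= t -> E1 t <= K.
  apply: (integral_lty_primitive_bounded _ _ dE1) => //.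
    by move=> t _; exact: (cn _ ce).
  move: he_int; congr (_ < _)%E; apply: eq_integral => t.
  by rewrite inE/= in_itv/= andbT => /tauE ->.
have [K2 EK2] : exists K, forall t, t0 <= t -> E2 t <= K.
  apply: (integral_lty_primitive_bounded _ _ dE2) => //.
    by move=> t _; exact: (cn _ ce').
  move: he'_int; congr (_ < _)%E; apply: eq_integral => t.
  by rewrite inE/= in_itv/= andbT => /tauE ->.
pose m := inf (range f).
have lbf : has_lbound (range f).
  by have [l lf] := hfbdd; exists l => _ [y _ <-]; exact: lf.
have dgp t : t0 < t ->
    a t + beta *: g' t = - ((alpha / t) *: v t) - g t - (e t + beta *: e' t).
  move=> t0t; have := hsol t t0t.
  have -> : derive1 (fun s => gradf (x s) + e s) t = g' t + e' t.
    by rewrite derive1E; have [] := is_derive1D (dg t t0t) (de t t0t).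
  rewrite scalerDr -/(g t) => h; apply/eqP; rewrite -subr_eq0 -{}h; apply/eqP.
  rewrite !opprD !opprK -!addrA; congr (_ + _); rewrite [LHS]addrCA.
  by do 2 congr (_ + _); rewrite [RHS]addrC addrA.
pose p t := v (tau t) + beta *: g (tau t).
have cp : continuous p.
  move=> t; rewrite /continuous_at /p; apply: cvgD; first exact: cv.
  by apply: cvgZl_tmp; exact: cg.
have [M [pM ci [p0 v0 g0 F0]]] : exists M,
    [/\ forall t, t0 <= t -> `|p t| <= M,
      (\int[lebesgue_measure]_(t in `[t0, +oo[)
        (alpha * (t^-1 * `|v (tau t)| ^+ 2) + beta * `|g (tau t)| ^+ 2)%:E < +oo)%E
    & [/\ `|p t| @[t --> +oo] --> 0, `|v (tau t)| @[t --> +oo] --> 0,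
          `|g (tau t)| @[t --> +oo] --> 0 & f (x (tau t)) @[t --> +oo] --> m]].
  apply: (@energy_asymptotics R H inner hinner t0 alpha beta m (K1 + beta * K2) f
    (fun t => x (tau t)) (fun t => v (tau t)) a (fun t => g (tau t))
    (fun t => e (tau t) + beta *: e' (tau t)) (fun t => f (x (tau t)))
    (fun t => `|e (tau t)| + beta * `|e' (tau t)|) (fun t => E1 t + beta * E2 t)) => //.
  - by move=> t t0t; rewrite tauE ?(ltW t0t)//; exact/is_derive1_comp_max/dx.
  - by move=> t t0t; exact/is_derive1_comp_max/dv.
  - move=> t t0t; rewrite tauE ?(ltW t0t)//.
    apply: (@is_derive1_comp_max R R t0 (fun s => f (x s))) => //.
    have [dfx dE] := gf (x t); have [xd xE] := dx t t0t.
    have dfxt : differentiable (f \o x) t.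
      by apply: differentiable_comp => //; exact/derivable1_diffP.
    apply: DeriveDef; first exact/derivable1_diffP.
    rewrite deriveE// diff_comp//=; last exact/derivable1_diffP.
    by rewrite dE -deriveE ?xE//; exact/derivable1_diffP.
  - move=> t t0t; rewrite tauE ?(ltW t0t)//.
    apply: (@is_derive1_comp_max R H t0 (fun s => v s + beta *: g s)) => //.
    by rewrite -dgp//; exact: is_derive1D (dv t t0t) (is_derive1Z beta (dg t t0t)).
  (* The two sides differ by [beta * <g', v>], nonnegative by monotonicity of the gradient. *)
  - move=> t t0t; rewrite tauE ?(ltW t0t)// -dgp// innerDl// innerZl// lerDl.
    apply: mulr_ge0; first exact: ltW.
    apply: (monotone_derive1_ge0 hinner _ (dg t t0t) (dx t t0t)) => s r.
    exact: convex_gradient_monotone gf hfconv _ _.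
  - by move=> t z; exact: convex_gradient_le gf hfconv _ _.
  - by move=> t; apply: ge_inf => //; exists (x (tau t)).
  - move=> rho rho0.
    have [|_ [z _ <-] fz] := @inf_adherent R (range f) rho rho0; last by exists z.
    by split => //; exists (f 0), 0.
  - by move=> t; apply: (le_trans (ler_normD _ _)); rewrite normrZ gtr0_norm.
  - by move=> t t0t; exact: is_derive1D (dE1 t t0t) (is_derive1Z beta (dE2 t t0t)).
  - by move=> t t0t; rewrite lerD ?EK1// ler_wpM2l ?EK2// ltW.
have du t : t0 < t -> derive1 u t = p t.
  move=> t0t.
  (* By [hu], [(u - x) / beta] is a weak primitive of [g]; hence [u' = v + beta g = p]. *)
  have dw : is_derive t 1 (fun s => beta^-1 *: (u s - x s)) (g (tau t)).
    apply: (@is_derive1_of_weak_primitive R H inner hinner t0 t _ (fun s => g (tau s))) => //.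
    move=> s t0s k; rewrite innerZl// innerBl// hu// addrAC subrr add0r mulKf ?gt_eqF//.
    apply: eq_Rintegral => r; rewrite inE/= in_itv/= => /andP[/tauE t0r _].
    by rewrite t0r.
  have := is_derive1D (dx t t0t) (is_derive1Z beta dw).
  under eq_fun do rewrite scalerA divff ?gt_eqF// scale1r addrC subrK.
  by move=> [_ duE]; rewrite derive1E duE /p tauE ?(ltW t0t).
have vE t : t0 < t -> derive1 x t = v (tau t).
  by move=> t0t; rewrite tauE ?(ltW t0t)// derive1E; have [] := dx t t0t.
have near_gt : \forall t \near +oo, t0 < t.
  by apply: nbhs_pinfty_gt; rewrite num_real.
split.
  by exists M => t t0t; rewrite du// pM// ltW.
have c_sqr (h : R -> H) : continuous h -> forall t, {for t, continuous (fun s => `|h s| ^+ 2)}.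
  by move=> ch t; apply: (@cvgM _ _ _ _ (fun s => `|h s|) (fun s => `|h s|)); exact: (cn _ ch).
have c_sqrV (h : R -> H) : continuous h -> forall t, t0 <= t ->
    {for t, continuous (fun s : R => s^-1 * `|h s| ^+ 2)}.
  move=> ch t t0t; rewrite /prop_for /continuous_at; apply: cvgM; last exact: c_sqr.
  by apply: inv_continuous; rewrite gt_eqF// (lt_le_trans ht0).
(* The integrable dissipation, which dominates all three integrands of (ii) up to constants. *)
pose c t := alpha * (t^-1 * `|v (tau t)| ^+ 2) + beta * `|g (tau t)| ^+ 2.
have ti t : t0 <= t -> 0 < t^-1 by move=> t0t; rewrite invr_gt0 (lt_le_trans ht0).
have c1 t : t0 <= t -> 0 <= alpha * (t^-1 * `|v (tau t)| ^+ 2).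
  by move=> /ti/ltW ?; rewrite mulr_ge0// ?mulr_ge0// ?sqr_ge0// ltW.
have c2 t : 0 <= beta * `|g (tau t)| ^+ 2 by rewrite mulr_ge0// ?sqr_ge0// ltW.
have cc t : t0 <= t -> {for t, continuous c}.
  move=> t0t; rewrite /prop_for /continuous_at /c; apply: cvgD; apply: cvgMl_tmp.
    exact: (c_sqrV _ cv).
  exact: (c_sqr _ cg).
have c0 t : t0 <= t -> 0 <= c t by move=> t0t; rewrite addr_ge0// c1.
split; [split|split; [split|]].
- apply: (@integral_lty_comparison R t0 alpha^-1 _ (fun t => t^-1 * `|v (tau t)| ^+ 2) c) => //.
  + exact: (c_sqrV _ cv).
  + by move=> t /vE ->.
  + move=> t t0t; rewrite mulr_ge0 ?sqr_ge0 ?(ltW (ti t t0t))//=.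
    by rewrite ler_pdivlMl// lerDl.
  + by rewrite invr_ge0 ltW.
- apply: (@integral_lty_comparison R t0 beta^-1 _ (fun t => `|g (tau t)| ^+ 2) c) => //.
  + by move=> t _; exact: (c_sqr _ cg).
  + by move=> t t0t; rewrite tauE ?(ltW t0t).
  + by move=> t t0t; rewrite sqr_ge0/= ler_pdivlMl// lerDr c1.
  + by rewrite invr_ge0 ltW.
(* The constant comes from [|p|^2 <= 2 |v|^2 + 2 beta^2 |g|^2] and, for the second term,
   [1 / t <= 1 / t0]. *)
- apply: (@integral_lty_comparison R t0 (2 / alpha + 2 * beta / t0) _
    (fun t => t^-1 * `|p t| ^+ 2) c) => //.
  + exact: (c_sqrV _ cp).
  + by move=> t /du ->.
  + move=> t t0t; have i0 := ti t t0t; rewrite mulr_ge0 ?sqr_ge0 ?(ltW i0)//=.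
    have := ler_wpM2l (ltW i0) (norm_sqrD_le hinner (v (tau t)) (beta *: g (tau t))).
    move=> /le_trans; apply.
    rewrite normrZ exprMn (gtr0_norm hbeta).
    have h1 : t^-1 * (2 * `|v (tau t)| ^+ 2) = 2 / alpha * (alpha * (t^-1 * `|v (tau t)| ^+ 2)).
      by field; rewrite !gt_eqF// (lt_le_trans ht0).
    have h2 : t^-1 * (2 * (beta ^+ 2 * `|g (tau t)| ^+ 2)) <=
        2 * beta / t0 * (beta * `|g (tau t)| ^+ 2).
      have -> : 2 * beta / t0 * (beta * `|g (tau t)| ^+ 2) =
          t0^-1 * (2 * (beta ^+ 2 * `|g (tau t)| ^+ 2)).
        by field; rewrite gt_eqF.
      apply: ler_wpM2r; first by rewrite mulr_ge0// mulr_ge0 ?sqr_ge0.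
      by rewrite lef_pV2 ?posrE// (lt_le_trans ht0).
    have h3 : 0 <= 2 * beta / t0 * (alpha * (t^-1 * `|v (tau t)| ^+ 2)).
      by rewrite mulr_ge0 ?c1// ltW// divr_gt0// mulr_gt0.
    have h4 : 0 <= 2 / alpha * (beta * `|g (tau t)| ^+ 2).
      by rewrite mulr_ge0// ltW// divr_gt0.
    by rewrite /c; lra.
  + by rewrite addr_ge0// ltW// divr_gt0// mulr_gt0.
- apply: cvg_trans p0; apply: near_eq_cvg; apply: filterS near_gt => t t0t.
  by rewrite du.
- apply: cvg_trans v0; apply: near_eq_cvg; apply: filterS near_gt => t t0t.
  by rewrite vE.
- apply: cvg_trans g0; apply: near_eq_cvg; apply: filterS near_gt => t t0t.
  by rewrite tauE ?(ltW t0t).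
- apply: cvg_trans F0; apply: near_eq_cvg; apply: filterS near_gt => t t0t.
  by rewrite tauE ?(ltW t0t).
Qed.
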